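(* Let $G=(V,E)$ be a strongly connected digraph that has a good decomposition $C_1,\dots,C_N$ with witness set $F$. Then for every integer $t\ge0$ and every $Q\subseteq F$, we have $y^{Q,t}\in SA^t(P)$, where $P$ is the cone of the balanced polytope of $G$.
   Context: Good decomposition: a strongly connected digraph $G=(V,E)$ has a good decomposition with witness set $F$ if $E$ is partitioned into edge-disjoint dicycles $C_1,\dots,C_N$ (so $E=\bigcup_j E(C_j)$), and $F$ is a nonempty subset of $\{1,\dots,N\}$ such that $G-E(C_j)$ is strongly connected for every $j\in F$. Balanced polytope of $G$: the set of $x\in\mathbb{R}^E$ with $x(\delta^{in}(S))\ge1$, $x(\delta^{out}(S))\ge1$ for all $\emptyset\subsetneq S\subsetneq V$, $x(\delta^{out}(\{v\}))=x(\delta^{in}(\{v\}))$ for all $v\in V$, $0\le x\le1$ ($\delta^{in},\delta^{out}$ = entering/leaving edges of $G$, $x(A)=\sum_{e\in A}x_e$). Its cone is $\{\lambda(1,x):\lambda\ge0,\ x\text{ in the polytope}\}$, i.e. the set of $(x_0,x)$ satisfying the homogenized constraints $\sum a_ix_i\ge bx_0$. Sherali–Adams for a cone: if $\hat P\subseteq[0,1]^n$ is described by inequalities $\sum_i a_iy_i\ge b$ (including $0\le y_i\le1$, equations as two inequalities) and $P$ is its cone, $SA^t(P)$ is the set of vectors $y=(y_S)$ indexed by subsets $S\subseteq\{1,\dots,n\}$ with $|S|\le t+1$ (including $S=\emptyset$) such that for every inequality and every pair of disjoint $S,Q'$ with $|S|+|Q'|\le t$: $\sum_i a_i\sum_{T\subseteq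 Q'}(-1)^{|T|}y_{S\cup T\cup\{i\}}\ge b\sum_{T\subseteq Q'}(-1)^{|T|}y_{S\cup T}$. The vector $y^{Q,t}$: indexed by all $S\subseteq E$ with $|S|\le t+1$, $y^{Q,t}_S=\frac{t+2-g_Q(S)}{t+2}$, where $g_Q(S)$ is the number of indices $j\in F-Q$ with $E(C_j)\cap S\neq\emptyset$. (In particular $y^{Q,t}_\emptyset=1$.) *)

(* Defs.v *)
From HB Require Import structures.
From mathcomp Require Import all_boot all_order all_algebra.

Set Implicit Arguments.
Unset Strict Implicit.
Unset Printing Implicit Defensive.

Import Order.TTheory GRing.Theory Num.Theory.
Local Open Scope ring_scope.

(* Edges form a type of their own, so that R^E is [edge G -> R]; parallel
   edges and loops are not excluded.  A loop enters and leaves no set. *)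
Record digraph : Type := Digraph {
  vertex : finType;
  edge : finType;
  source : edge -> vertex;
  target : edge -> vertex
}.

Section Digraphs.
Variable G : digraph.
Implicit Types (A S : {set edge G}) (W : {set vertex G}).

Definition adjacent A : rel (vertex G) :=
  fun u v => [exists e in A, (source e == u) && (target e == v)].

Definition strongly_connected_on A : Prop :=
  forall u v, connect (adjacent A) u v.

Definition strongly_connected : Prop := strongly_connected_on [set: edge G].

Definition delta_in W : {set edge G} :=
  [set e | (source e \notin W) && (target e \in W)].

Definition delta_out W : {set edge G} :=
  [set e | (source e \in W) && (target e \notin W)].

(* A directed cycle is listed by its consecutive edges, starting anywhere;
   it visits no vertex twice. *)
Definition dicycle (c : seq (edge G)) : bool :=
  [&& c != [::], cycle (fun e f => target e == source f) c
    & uniq [seq source e | e <- c]].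

Definition cycle_edges (c : seq (edge G)) : {set edge G} := [set e in c].

Record good_decomposition (N : nat) (C : 'I_N -> seq (edge G))
    (F : {set 'I_N}) : Prop := GoodDecomposition {
  gd_dicycle : forall j, dicycle (C j);
  gd_disjoint : forall i j, i != j ->
    [disjoint cycle_edges (C i) & cycle_edges (C j)];
  gd_cover : \bigcup_j cycle_edges (C j) = [set: edge G];
  gd_witness_neq0 : F != set0;
  gd_witness : forall j, j \in F ->
    strongly_connected_on (~: cycle_edges (C j))
}.

End Digraphs.

(* [sys a b] : the inequality \sum_i a_i x_i >= b belongs to the system. *)
Definition lin_system (R : realFieldType) (E : finType) : Type :=
  (E -> R) -> R -> Prop.

Section LinSystems.
Variables (R : realFieldType) (E : finType).
Implicit Types (sys : lin_system R E) (x : E -> R) (y : {set E} -> R).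

Definition polytope_of sys x : Prop :=
  forall a b, sys a b -> b <= \sum_i a i * x i.

Definition homogenized sys (x0 : R) x : Prop :=
  forall a b, sys a b -> b * x0 <= \sum_i a i * x i.

Definition cone_of (P : (E -> R) -> Prop) (x0 : R) x : Prop :=
  exists2 l : R, 0 <= l &
    exists2 z, P z & x0 = l /\ forall i, x i = l * z i.

(* The lift depends on the cone through the inequalities describing it.  Only
   the entries y_S with #|S| <= t + 1 are read; see [sherali_adams_local]. *)
Definition sherali_adams (t : nat) sys y : Prop :=
  forall a b, sys a b ->
  forall S Q : {set E}, [disjoint S & Q] -> (#|S| + #|Q| <= t)%N ->
    b * (\sum_(T : {set E} | T \subset Q) (-1) ^+ #|T| * y (S :|: T))
    <= \sum_i a i *
         (\sum_(T : {set E} | T \subset Q)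
            (-1) ^+ #|T| * y (S :|: T :|: [set i])).

Lemma sherali_adams_local t sys y y' :
    (forall S : {set E}, (#|S| <= t.+1)%N -> y S = y' S) ->
  sherali_adams t sys y -> sherali_adams t sys y'.
Proof.
move=> eqy yP a b ab S Q dSQ leSQ.
have leT (T : {set E}) : T \subset Q -> (#|S :|: T| <= t)%N.
  move=> sTQ; apply: leq_trans leSQ; apply: leq_trans (leq_card_setU _ _) _.
  by rewrite leq_add2l subset_leq_card.
have := yP a b ab S Q dSQ leSQ; congr (_ * _ <= _).
  by apply: eq_bigr => T /leT le; rewrite eqy // (leq_trans le).
apply: eq_bigr => i _; congr (_ * _); apply: eq_bigr => T /leT le.
rewrite eqy //; apply: leq_trans (leq_card_setU _ _) _.
by rewrite cards1 addn1 ltnS.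
Qed.

Definition indic (A : {set E}) (e : E) : R := (e \in A)%:R.

Lemma sum_indic A x : \sum_e indic A e * x e = \sum_(e in A) x e.
Proof.
rewrite [RHS]big_mkcond; apply: eq_bigr => e _.
by rewrite /indic; case: (e \in A); rewrite ?mul1r ?mul0r.
Qed.

End LinSystems.

Section Balanced.
Variables (R : realFieldType) (G : digraph).
Implicit Types (x : edge G -> R).

Record balanced_polytope x : Prop := BalancedPolytope {
  bal_in : forall W : {set vertex G}, W != set0 -> W != setT ->
    1 <= \sum_(e in delta_in W) x e;
  bal_out : forall W : {set vertex G}, W != set0 -> W != setT ->
    1 <= \sum_(e in delta_out W) x e;
  bal_eq : forall v : vertex G,
    \sum_(e in delta_out [set v]) x e = \sum_(e in delta_in [set v]) x e;
  bal_01 : forall e, 0 <= x e <= 1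
}.

Inductive balanced_system : lin_system R (edge G) :=
| BalIn (W : {set vertex G}) : W != set0 -> W != setT ->
    balanced_system (indic R (delta_in W)) 1
| BalOut (W : {set vertex G}) : W != set0 -> W != setT ->
    balanced_system (indic R (delta_out W)) 1
| BalGe (v : vertex G) :
    balanced_system
      (fun e => indic R (delta_out [set v]) e - indic R (delta_in [set v]) e) 0
| BalLe (v : vertex G) :
    balanced_system
      (fun e => indic R (delta_in [set v]) e - indic R (delta_out [set v]) e) 0
| BalGe0 (e : edge G) : balanced_system (indic R [set e]) 0
| BalLe1 (e : edge G) : balanced_system (fun f => - indic R [set e] f) (- 1).

Lemma homogenized_balancedP (x0 : R) x :
  homogenized balanced_system x0 x <->
  [/\ forall W : {set vertex G}, W != set0 -> W != setT ->
        x0 <= \sum_(e in delta_in W) x e,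
      forall W : {set vertex G}, W != set0 -> W != setT ->
        x0 <= \sum_(e in delta_out W) x e,
      forall v : vertex G,
        \sum_(e in delta_out [set v]) x e = \sum_(e in delta_in [set v]) x e
    & forall e, 0 <= x e <= x0].
Proof.
have subE (A B : {set edge G}) :
    \sum_e (indic R A e - indic R B e) * x e
    = \sum_(e in A) x e - \sum_(e in B) x e.
  rewrite -!sum_indic -sumrB; apply: eq_bigr => e _; exact: mulrBl.
have oppE (e : edge G) : \sum_f (- indic R [set e] f) * x f = - x e.
  under eq_bigr do rewrite mulNr.
  by rewrite sumrN sum_indic big_set1.
split=> [h | [h1 h2 h3 h4] a b].
  split=> [W W0 WT | W W0 WT | v | e].
  - by have := h _ _ (BalIn W0 WT); rewrite sum_indic mul1r.
  - by have := h _ _ (BalOut W0 WT); rewrite sum_indic mul1r.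
  - have := h _ _ (BalGe v); have := h _ _ (BalLe v).
    by rewrite !subE mul0r !subr_ge0 => ? ?; apply/le_anti/andP.
  - have := h _ _ (BalGe0 e); have := h _ _ (BalLe1 e).
    by rewrite oppE sum_indic big_set1 mul0r mulN1r lerN2 => -> ->.
case=> {a b} [W W0 WT | W W0 WT | v | v | e | e].
- by rewrite sum_indic mul1r h1.
- by rewrite sum_indic mul1r h2.
- by rewrite subE mul0r h3 subrr.
- by rewrite subE mul0r h3 subrr.
- by rewrite sum_indic big_set1 mul0r; case/andP: (h4 e).
- by rewrite oppE mulN1r lerN2; case/andP: (h4 e).
Qed.

Lemma polytope_of_balanced x :
  polytope_of balanced_system x <-> balanced_polytope x.
Proof.
split=> [h | [h1 h2 h3 h4] a b ab].
  have /homogenized_balancedP[] : homogenized balanced_system 1 x by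
    move=> a b /h; rewrite mulr1.
  by split.
have /homogenized_balancedP h : [/\ _, _, _ & _] := And4 h1 h2 h3 h4.
by rewrite -[b]mulr1; apply: h.
Qed.

(* The hypotheses exclude a negative x0 and an empty polytope; both hold when
   G is strongly connected and has a good decomposition. *)
Lemma cone_of_balanced (x0 : R) x :
    (0 < #|edge G|)%N -> (exists z, balanced_polytope z) ->
  cone_of balanced_polytope x0 x <-> homogenized balanced_system x0 x.
Proof.
case/card_gt0P=> e0 _ [z0 z0P]; split.
  case=> l l0 [z /polytope_of_balanced zP [-> xE]] a b /zP h.
  rewrite (eq_bigr (fun i => l * (a i * z i))) => [|i _]; last first.
    by rewrite xE mulrCA.
  by rewrite -mulr_sumr mulrC ler_wpM2l.
move=> h; have [_ _ _ h01] := (homogenized_balancedP _ _).1 h.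
have x0_ge0 : 0 <= x0 by case/andP: (h01 e0); apply: le_trans.
exists x0 => //; case: (eqVneq x0 0) => [x00 | x0N0].
  exists z0 => //; split=> // e; rewrite x00 mul0r.
  by apply/le_anti; have := h01 e; rewrite x00 andbC.
have x0_gt0 : 0 < x0 by rewrite lt_def x0N0.
exists (fun e => x e / x0); last by split=> // e; rewrite mulrCA divff ?mulr1.
apply/polytope_of_balanced => a b /h; under [X in _ -> _ <= X]eq_bigr do rewrite mulrA.
by rewrite -mulr_suml ler_pdivlMr.
Qed.

End Balanced.

Section Vector.
Variables (R : realFieldType) (G : digraph).
Variables (N : nat) (C : 'I_N -> seq (edge G)) (F Q : {set 'I_N}).

Definition hit_count (S : {set edge G}) : nat :=
  #|[set j in F :\: Q | cycle_edges (C j) :&: S != set0]|.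

Definition sa_vector (t : nat) (S : {set edge G}) : R :=
  (t.+2%:R - (hit_count S)%:R) / t.+2%:R.

End Vector.

(* Main.v *)
(** Write [D = t + 2] and [J = F \ Q].  Up to the constant [1 - #|J| / D] in
    every entry, the vector [y^{Q,t}] is [1 / D] times the sum over [j] in [J]
    of the moment vectors of the 0/1 points [x_j], the indicators of
    [E - E(C_j)], and each [x_j] lies in the balanced polytope.  If the set
    [Q'] of complemented variables is nonempty, the alternating sum kills the
    constant and the lifted inequality is a nonnegative combination of
    inequalities valid at the [x_j].  If [Q'] is empty, then [y_S >= 2 / D]
    and adding an edge to [S] costs at most [1 / D], so two edges of a cut
    suffice; a cut met by only one edge of [G] avoids all the witness cycles,
    and adding that edge costs nothing. *)
Require Import Defs.
From mathcomp Require Import all_boot all_order all_algebra.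

Set Implicit Arguments.
Unset Strict Implicit.
Unset Printing Implicit Defensive.

Import Order.TTheory GRing.Theory Num.Theory.
Local Open Scope ring_scope.

(** * Alternating sums over subsets *)

Section AlternatingSums.
Variables (R : realFieldType) (E : finType).
Implicit Types A B P S T : {set E}.

(** The sum is the expansion of the product of all [f e + 1], where a single element of [A]
    contributes a zero factor. *)
Lemma sum_sign_subset A :
  \sum_(T : {set E} | T \subset A) (-1) ^+ #|T| = (A == set0)%:R :> R.
Proof.
pose f e : R := if e \in A then -1 else 0.
have : \sum_(T : {set E}) \prod_e (if e \in T then f e else 1)
    = \prod_e (f e + 1).
  by rewrite bigA_distr; apply: eq_bigl => T; rewrite inE.
rewrite (bigID (fun T => T \subset A)) /= [X in _ + X]big1 ?addr0; last first.
  move=> T /subsetPn[e eT eA]; rewrite (bigD1 e) //= eT /f (negPf eA).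
  by rewrite mul0r.
rewrite (eq_bigr (fun T => (-1) ^+ #|T|)) => [->|T sTA]; last first.
  rewrite -big_mkcond /= -prodr_const; apply: eq_bigr => e eT.
  by rewrite /f (subsetP sTA).
case: eqP => [A0|/eqP/set0Pn[e eA]].
  by rewrite big1 // => e _; rewrite /f A0 inE add0r.
by rewrite (bigD1 e) //= /f eA addNr mul0r.
Qed.

(** This expands the product of [x_e] over [S] and [1 - x_e] over [P] at the 0/1 point [x] that
    indicates [B]: the sets [T] that count are the subsets of [P :&: B]. *)
Lemma sum_sign_subsetU P S B :
  \sum_(T : {set E} | T \subset P) (-1) ^+ #|T| * (S :|: T \subset B)%:R
  = ((S \subset B) && (P :&: B == set0))%:R :> R.
Proof.
under eq_bigr do rewrite subUset.
case: (S \subset B) => /=; last by rewrite big1 // => T _; rewrite mulr0.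
rewrite -sum_sign_subset.
under [RHS]eq_bigl do rewrite subsetI.
rewrite big_mkcondr /=; apply: eq_bigr => T _.
by case: ifP; rewrite ?mulr1 ?mulr0.
Qed.

End AlternatingSums.

(** * Cuts in strongly connected digraphs *)

Lemma strongly_connected_on_delta_out (G : digraph) (A : {set edge G})
    (W : {set vertex G}) :
    strongly_connected_on A -> W != set0 -> W != setT ->
  exists2 e, e \in A & e \in delta_out W.
Proof.
move=> scA /set0Pn[u uW]; rewrite -subTset => /subsetPn[v _].
have /connectP[p] := scA u v; elim: p u uW => [|w p IHp] u uW /=.
  by move=> _ ->; rewrite uW.
case/andP=> /exists_inP[e eA /andP[/eqP su /eqP tw]].
(* The first edge of the path that leaves [W] is the one sought. *)
have [wW|wW _ _ _] := boolP (w \in W); first exact: IHp.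
by exists e; rewrite // inE su uW tw.
Qed.

Lemma delta_inE (G : digraph) (W : {set vertex G}) :
  delta_in W = delta_out (~: W).
Proof. by apply/setP=> e; rewrite !inE negbK. Qed.

Lemma strongly_connected_on_delta_in (G : digraph) (A : {set edge G})
    (W : {set vertex G}) :
    strongly_connected_on A -> W != set0 -> W != setT ->
  exists2 e, e \in A & e \in delta_in W.
Proof.
move=> scA W0 WT; rewrite delta_inE; apply: strongly_connected_on_delta_out => //.
  by rewrite -setCT (inj_eq (@setC_inj _)).
by rewrite -setC0 (inj_eq (@setC_inj _)).
Qed.

(** * Flow conservation along dicycles *)

Section Divergence.
Variables (R : realFieldType) (G : digraph).

Lemma dicycle_balanced (c : seq (edge G)) v : dicycle c ->
  \sum_(e in cycle_edges c) ((source e == v)%:R - (target e == v)%:R) = 0 :> R.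
Proof.
case/and3P=> _ cyc /map_uniq uc.
(* Each target is the next source, so both terms sum over the same vertices. The induction varies
   the starting edge and keeps the closing edge [e0] fixed. *)
have eq_rot : map (@target G) c = rot 1 (map (@source G) c).
  case: c cyc {uc} => //= e0 c; rewrite rot1_cons.
  elim: c {1 3}e0 => [|f c IHc] e /=; first by rewrite andbT => /eqP->.
  by case/andP=> /eqP-> /IHc->.
rewrite (eq_bigl (mem c)) => [|e]; last by rewrite inE.
rewrite -big_uniq // sumrB -(big_map (@source G) predT (fun u => (u == v)%:R)).
rewrite -(big_map (@target G) predT (fun u => (u == v)%:R)) eq_rot.
rewrite (perm_big (rot 1 (map (@source G) c))) ?subrr //.
by rewrite perm_sym perm_rot.
Qed.

(** A loop at [v] lies in neither cut, and its two signs cancel. *)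
Lemma divergence_eq0 (x : edge G -> R) v :
    \sum_e ((source e == v)%:R - (target e == v)%:R) * x e = 0 ->
  \sum_(e in delta_out [set v]) x e = \sum_(e in delta_in [set v]) x e.
Proof.
move=> div0; apply: subr0_eq; apply: etrans div0.
rewrite -!sum_indic -sumrB; apply: eq_bigr => e _; rewrite -mulrBl /indic !inE.
by case: (source e == v); case: (target e == v); rewrite ?subrr.
Qed.

End Divergence.

(** * The 0/1 points given by the witness cycles *)

Section GoodDecomposition.
Variables (R : realFieldType) (G : digraph) (N : nat).
Variables (C : 'I_N -> seq (edge G)) (F : {set 'I_N}).
Hypothesis hC : good_decomposition C F.

Lemma cycle_index : exists k : edge G -> 'I_N,
  forall e j, (e \in cycle_edges (C j)) = (k e == j).
Proof.
have /fin_all_exists[k kP] (e : edge G) : exists j, e \in cycle_edges (C j).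
  have : e \in \bigcup_j cycle_edges (C j) by rewrite (gd_cover hC) inE.
  by case/bigcupP=> j _; exists j.
exists k => e j; have [<-|/eqP nkj] := (k e =P j); first exact: kP.
exact: (disjointFr (gd_disjoint hC nkj) (kP e)).
Qed.

(** A weight that is constant on each cycle is a linear combination of cycle indicators, each of
    which is balanced. *)
Lemma cycle_index_balanced (k : edge G -> 'I_N) (h : 'I_N -> R) v :
    (forall e j, (e \in cycle_edges (C j)) = (k e == j)) ->
  \sum_(e in delta_out [set v]) h (k e) = \sum_(e in delta_in [set v]) h (k e).
Proof.
move=> kP; apply: (divergence_eq0 (x := h \o k)) => /=.
rewrite (partition_big k predT) //= big1 // => j _.
under eq_bigr => e /eqP-> do [].
rewrite -mulr_suml; under eq_bigl do rewrite -kP.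
by rewrite dicycle_balanced ?mul0r ?(gd_dicycle hC).
Qed.

Lemma witness_complement_balanced j :
  j \in F -> balanced_polytope (indic R (~: cycle_edges (C j))).
Proof.
move=> jF; have [k kP] := cycle_index.
have x_ge0 e : 0 <= indic R (~: cycle_edges (C j)) e by rewrite ler0n.
have ge1 (A : {set edge G}) e : e \in ~: cycle_edges (C j) -> e \in A ->
    1 <= \sum_(f in A) indic R (~: cycle_edges (C j)) f.
  by move=> eC eA; rewrite (bigD1 e) //= {1}/indic eC lerDl sumr_ge0.
have sc := gd_witness hC jF; split=> [W W0 WT|W W0 WT|v|e].
- by have [e] := strongly_connected_on_delta_in sc W0 WT; apply: ge1.
- by have [e] := strongly_connected_on_delta_out sc W0 WT; apply: ge1.
- have xE e : indic R (~: cycle_edges (C j)) e = (k e != j)%:R.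
    by rewrite /indic inE kP.
  under eq_bigr do rewrite xE; under [RHS]eq_bigr do rewrite xE.
  exact: (cycle_index_balanced (fun i => (i != j)%:R)).
- by rewrite x_ge0 /indic lern1 leq_b1.
Qed.

(** * Decomposition into moment vectors, and the case of complemented variables *)

Variables (t : nat) (Q : {set 'I_N}).
Implicit Types A B P S : {set edge G}.
Local Notation y := (sa_vector R C F Q t).
Local Notation D := (t.+2%:R : R).
Local Notation hit S := (hit_count C F Q S).

(** The first term does not depend on [S] and may be negative, so this need not be a convex
    combination. *)
Lemma sa_vectorE S : y S = (D - #|F :\: Q|%:R) / D
  + D^-1 * \sum_(j in F :\: Q) (S \subset ~: cycle_edges (C j))%:R.
Proof.
rewrite /sa_vector mulrC [X in _ = X + _]mulrC -mulrDr; congr (_ * _).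
rewrite -[RHS]addrA; congr (_ + _).
rewrite /hit_count -!sum1_card !natr_sum [RHS]addrC -[RHS]opprB -sumrB; congr (- _).
rewrite (eq_bigl (fun j => (j \in F :\: Q)
  && (cycle_edges (C j) :&: S != set0))) => [|j]; last by rewrite inE.
rewrite big_mkcondr; apply: eq_bigr => j _ /=.
by rewrite subsetC -disjoints_subset -setI_eq0; case: eqP; rewrite ?subrr ?subr0.
Qed.

Lemma sa_vector_alternating P S : P != set0 ->
  \sum_(T : {set edge G} | T \subset P) (-1) ^+ #|T| * y (S :|: T)
  = D^-1 * \sum_(j in F :\: Q)
      ((S \subset ~: cycle_edges (C j))
       && (P :&: ~: cycle_edges (C j) == set0))%:R.
Proof.
move=> P0; under eq_bigr do rewrite sa_vectorE mulrDr.
rewrite big_split /= -mulr_suml sum_sign_subset (negPf P0) mul0r add0r.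
under eq_bigr do rewrite mulrCA.
rewrite -mulr_sumr; congr (_ * _).
under [LHS]eq_bigr do rewrite mulr_sumr.
rewrite exchange_big /=; apply: eq_bigr => j _; exact: sum_sign_subsetU.
Qed.

(** At the point of index [j], the lifted inequality is the original one times the weight [w], which
    is 1 if [S] avoids the cycle [C j] and [P] lies in it, and 0 otherwise. *)
Lemma sherali_adams_complemented a b S P :
    balanced_system a b -> P != set0 ->
  b * (\sum_(T : {set edge G} | T \subset P) (-1) ^+ #|T| * y (S :|: T))
  <= \sum_i a i * (\sum_(T : {set edge G} | T \subset P)
                     (-1) ^+ #|T| * y (S :|: T :|: [set i])).
Proof.
move=> ab P0; rewrite sa_vector_alternating //.
under [leRHS]eq_bigr => i _.
  under eq_bigr do rewrite setUAC.
  rewrite sa_vector_alternating // mulrCA; over.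
rewrite -mulr_sumr mulrCA ler_wpM2l ?invr_ge0 ?ler0n //.
under [leRHS]eq_bigr do rewrite mulr_sumr.
rewrite mulr_sumr exchange_big /= ler_sum // => j; rewrite inE => /andP[_ jF].
have /polytope_of_balanced/(_ _ _ ab) := witness_complement_balanced jF.
set B := ~: _ => le_b; set w : R := _%:R.
rewrite (eq_bigr (fun i => a i * indic R B i * w)) => [|i _].
  by rewrite -mulr_suml ler_wpM2r ?ler0n.
rewrite -mulrA /indic /w -natrM mulnb subUset sub1set; congr (_ * _%:R).
by rewrite andbAC andbC.
Qed.

(** * Hit counts, and the case without complemented variables *)

Lemma hit_countE (k : edge G -> 'I_N) S :
    (forall e j, (e \in cycle_edges (C j)) = (k e == j)) ->
  hit S = #|(F :\: Q) :&: k @: S|.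
Proof.
move=> kP; apply: eq_card => j; rewrite inE [RHS]inE; congr (_ && _).
apply/set0Pn/imsetP=> [[e]|[e eS ->]].
  by rewrite inE kP => /andP[/eqP<- eS]; exists e.
by exists e; rewrite inE kP eqxx.
Qed.

Lemma hit_countS A B : A \subset B -> (hit A <= hit B)%N.
Proof.
move=> sAB; have [k kP] := cycle_index.
by rewrite !(hit_countE _ kP) subset_leq_card // setIS // imsetS.
Qed.

Lemma hit_count_leq_card S : (hit S <= #|S|)%N.
Proof.
have [k kP] := cycle_index; rewrite (hit_countE _ kP).
by apply: leq_trans (leq_imset_card k S); rewrite subset_leq_card ?subsetIr.
Qed.

Lemma hit_countU1 S e : (hit (S :|: [set e]) <= (hit S).+1)%N.
Proof.
have [k kP] := cycle_index; rewrite !(hit_countE _ kP) imsetU imset_set1 setIUr.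
apply: leq_trans (leq_card_setU _ _) _; rewrite -addn1 leq_add2l.
by rewrite -(cards1 (k e)) subset_leq_card ?subsetIr.
Qed.

Lemma hit_countU1_notin S e :
    (forall j, j \in F -> e \notin cycle_edges (C j)) ->
  hit (S :|: [set e]) = hit S.
Proof.
move=> eF; have [k kP] := cycle_index.
rewrite !(hit_countE _ kP) imsetU imset_set1 setIUr.
suff /disjoint_setI0-> : [disjoint F :\: Q & [set k e]] by rewrite setU0.
rewrite disjoint_sym disjoints1 inE negb_and; apply/orP; right.
by apply/negP=> /eF; rewrite kP eqxx.
Qed.

Lemma sa_vector_leq S A : (hit S <= hit A)%N -> y A <= y S.
Proof.
by move=> le; rewrite ler_pM2r ?invr_gt0 ?ltr0n // lerD2l lerN2 ler_nat.
Qed.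

Lemma sa_vector_ge0 S : (#|S| <= t.+2)%N -> 0 <= y S.
Proof.
move=> leS; rewrite divr_ge0 ?ler0n // subr_ge0 ler_nat.
exact: leq_trans (hit_count_leq_card S) leS.
Qed.

Lemma sa_vector_cut A S : (#|S| <= t)%N ->
    (exists e, e \in A) ->
    (forall j, j \in F -> exists2 e, e \in ~: cycle_edges (C j) & e \in A) ->
  y S <= \sum_(e in A) y (S :|: [set e]).
Proof.
move=> leS [e eA] exA.
have ge0 f : 0 <= y (S :|: [set f]).
  apply: sa_vector_ge0; apply: leq_trans (leq_card_setU _ _) _.
  by rewrite cards1 addn1 ltnS leqW.
rewrite (bigD1 e) //=.
have [/existsP[j /andP[jF ej]]|/existsPn eF] :=
    boolP [exists j, (j \in F) && (e \in cycle_edges (C j))]; last first.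
  rewrite [y (_ :|: [set e])]/sa_vector hit_countU1_notin.
    by rewrite lerDl sumr_ge0.
  by move=> j jF; have := eF j; rewrite jF.
(* Since [e] lies on the witness cycle [C j], an edge of [A] off that cycle is distinct from [e]. *)
have [f fj fA] := exA j jF.
have ef : f != e by apply: contraTneq fj => ->; rewrite inE ej.
rewrite (bigD1 f) /= ?fA // addrA; apply: le_trans (_ : _ <= y (S :|: [set e])
  + y (S :|: [set f])) _; last by rewrite lerDl sumr_ge0.
have D_gt0 : 0 < D by rewrite ltr0n.
rewrite /sa_vector -mulrDl ler_pM2r ?invr_gt0 //.
(* Each edge adds at most one hit, and [hit S] is at most [t]; the two extra hits account for the 2
   in the denominator [t + 2]. *)
have : (hit (S :|: [set e]) + hit (S :|: [set f]) <= t.+2 + hit S)%N.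
  apply: leq_trans (leq_add (hit_countU1 S e) (hit_countU1 S f)) _.
  by rewrite addSnnS addnC leq_add2r !ltnS (leq_trans (hit_count_leq_card S)).
rewrite -(ler_nat R) !natrD; move: D => d le_hit.
by rewrite addrACA -opprD -addrA lerD2l lerBrDr addrC lerBlDr.
Qed.

Lemma sa_vector_homogenized S : strongly_connected G -> (#|S| <= t)%N ->
  homogenized (@balanced_system R G) (y S) (fun e => y (S :|: [set e])).
Proof.
move=> hG leS; apply/homogenized_balancedP; split=> [W W0 WT|W W0 WT|v|e].
- apply: sa_vector_cut => // [|j /(gd_witness hC) sc].
    by have [e _ eW] := strongly_connected_on_delta_in hG W0 WT; exists e.
  exact: strongly_connected_on_delta_in sc W0 WT.
- apply: sa_vector_cut => // [|j /(gd_witness hC) sc].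
    by have [e _ eW] := strongly_connected_on_delta_out hG W0 WT; exists e.
  exact: strongly_connected_on_delta_out sc W0 WT.
- have [k kP] := cycle_index.
  (* For fixed [S], the entry at [S :|: [set e]] depends only on the cycle through [e], hence is
     balanced. *)
  pose h i : R := (D - #|(F :\: Q) :&: (k @: S :|: [set i])|%:R) / D.
  have yE e : y (S :|: [set e]) = h (k e).
    by rewrite /sa_vector (hit_countE _ kP) imsetU imset_set1.
  under eq_bigr do rewrite yE; under [RHS]eq_bigr do rewrite yE.
  exact: cycle_index_balanced.
- rewrite sa_vector_leq ?hit_countS ?subsetUl // andbT sa_vector_ge0 //.
  apply: leq_trans (leq_card_setU _ _) _.
  by rewrite cards1 addn1 ltnS leqW.
Qed.

End GoodDecomposition.

Theorem theorem1 (R : realFieldType) (G : digraph)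
    (hG : strongly_connected G)
    (N : nat) (C : 'I_N -> seq (edge G)) (F : {set 'I_N})
    (hC : good_decomposition C F)
    (t : nat) (Q : {set 'I_N}) (hQ : Q \subset F) :
  sherali_adams t (@balanced_system R G) (sa_vector R C F Q t).
Proof.
move=> a b ab S P _ leSP.
(* For empty [P] only [T = set0] remains, and the claim is the homogenized system with the entry at
   [S] as [x0]. *)
have [P0|PN0] := eqVneq P set0; last exact: sherali_adams_complemented.
have sum0 (y : {set edge G} -> R) :
    \sum_(T : {set edge G} | T \subset P) (-1) ^+ #|T| * y T = y set0.
  by rewrite P0 (eq_bigl _ _ (@subset0 _)) big_pred1_eq cards0 mul1r.
rewrite (sum0 (fun T => sa_vector R C F Q t (S :|: T))) setU0.
under [leRHS]eq_bigr => i _.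
  rewrite (sum0 (fun T => sa_vector R C F Q t (S :|: T :|: [set i]))) setU0; over.
apply: sa_vector_homogenized => //.
by apply: leq_trans leSP; apply: leq_addr.
Qed.
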